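(* Let $G$ be a discrete group, $\Lambda$ a $k$-graph and $c:\Lambda\to G$ a functor. Let $\tilde c:\mathcal{G}_\Lambda\to G$ be the cocycle given by $\tilde c(x,\ell-m,y)=c(x(0,\ell))\,c(y(0,m))^{-1}$ whenever $\sigma^\ell x=\sigma^m y$. Then there is an isomorphism of topological groupoids $\mathcal{G}_{G\times_c\Lambda}\cong\mathcal{G}_\Lambda(\tilde c)$, where $G\times_c\Lambda$ is the skew product $k$-graph and $\mathcal{G}_\Lambda(\tilde c)$ is the skew product groupoid.
   Context: Let $\mathbf{N}=\{0,1,2,\dots\}$, $k\ge 1$, and order $\mathbf{N}^k$ coordinatewise. A $k$-graph $(\Lambda,d)$ is a countable small category $\Lambda$ (range map $r$, source map $s$) with a functor $d:\Lambda\to\mathbf{N}^k$ satisfying the factorisation property: if $d(\lambda)=m+n$ there are unique $\mu,\nu\in\Lambda$ with $\lambda=\mu\nu$, $d(\mu)=m$, $d(\nu)=n$. $\lambda\mu$ is defined iff $s(\lambda)=r(\mu)$. Put $\Lambda^n=d^{-1}(n)$; $\Lambda^0$ is identified with the set of objects; $\Lambda^n(v)=\{\lambda\in\Lambda^n: r(\lambda)=v\}$. Standing assumption: $0<\#\Lambda^n(v)<\infty$ for all $v\in\Lambda^0$, $n\in\mathbf{N}^k$. $\Omega_k=\{(m,n)\in\mathbf{N}^k\times\mathbf{N}^k: m\le n\}$ is the $k$-graph with objects $\mathbf{N}^k$, $r(m,n)=m$, $s(m,n)=n$, $d(m,n)=n-m$. $\Lambda^\infty$ is the set of degree-preserving functors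 $x:\Omega_k\to\Lambda$; $x(m)$ denotes $x(m,m)$; $\sigma^p(x)(m,n)=x(m+p,n+p)$. If $x(0)=s(\lambda)$, then $\lambda x$ is the unique $y\in\Lambda^\infty$ with $\sigma^{d(\lambda)}y=x$ and $y(0,d(\lambda))=\lambda$. $\mathcal{G}_\Lambda=\{(x,n,y)\in\Lambda^\infty\times\mathbf{Z}^k\times\Lambda^\infty:\sigma^\ell x=\sigma^m y,\ n=\ell-m\text{ for some }\ell,m\in\mathbf{N}^k\}$ with $r(x,n,y)=x$, $s(x,n,y)=y$, $(x,n,y)(y,\ell,z)=(x,n+\ell,z)$, $(x,n,y)^{-1}=(y,-n,x)$, and topology with basis $Z(\lambda,\mu)=\{(\lambda z,d(\lambda)-d(\mu),\mu z): z\in\Lambda^\infty,\ z(0)=s(\lambda)\}$, $s(\lambda)=s(\mu)$. A functor $c:\Lambda\to G$ is a map with $c(\lambda\mu)=c(\lambda)c(\mu)$ for composable $\lambda,\mu$ and $c(v)=1$ for $v\in\Lambda^0$. The skew product $G\times_c\Lambda$ has objects $G\times\Lambda^0$, morphisms $G\times\Lambda$, $s(g,\lambda)=(gc(\lambda),s(\lambda))$, $r(g,\lambda)=(g,r(\lambda))$, $(g,\lambda)(gc(\lambda),\mu)=(g,\lambda\mu)$, and $d(g,\lambda)=d(\lambda)$. The map $\tilde c$ is a well-defined continuous cocycle (groupoid homomorphism into $G$). The skew product groupoid $\mathcal{G}_\Lambda(\tilde c)$ is $\mathcal{G}_\Lambda\times G$ with the product topology, with $(\gamma,g)$ and $(\gamma',g')$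 composable iff $\gamma,\gamma'$ are composable and $g'=g\tilde c(\gamma)$, product $(\gamma\gamma',g)$, and inverse $(\gamma,g)^{-1}=(\gamma^{-1},g\tilde c(\gamma))$. If $G$ is uncountable then $G\times_c\Lambda$ is not a countable category, but the definition of its path groupoid is the same. *)

(* Defs.v *)
From HB Require Import structures.
From mathcomp Require Import all_boot all_order all_algebra.
From mathcomp Require Import all_classical topology.

Set Implicit Arguments.
Unset Strict Implicit.
Unset Printing Implicit Defensive.

Import GRing.Theory.
Local Open Scope classical_set_scope.
Local Open Scope ring_scope.

Notation degree k := {ffun 'I_k -> nat}.
Notation zdegree k := {ffun 'I_k -> int}.

Definition degree_le k (m n : degree k) : bool := [forall i, (m i <= n i)%N].

(* Truncated; only ever used when [degree_le n m]. *)
Definition degree_sub k (m n : degree k) : degree k := [ffun i => (m i - n i)%N].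

Definition zdiff k (l m : degree k) : zdegree k :=
  [ffun i => (l i)%:Z - (m i)%:Z].

Lemma degree_addE k (m n : degree k) i : (m + n) i = (m i + n i)%N.
Proof. by rewrite ffunE. Qed.

Lemma degree_leP k (m n : degree k) :
  reflect (forall i, (m i <= n i)%N) (degree_le m n).
Proof. exact: forallP. Qed.

Lemma degree_le_refl k (m : degree k) : degree_le m m.
Proof. by apply/degree_leP => i. Qed.

Lemma degree_le_trans k (n m p : degree k) :
  degree_le m n -> degree_le n p -> degree_le m p.
Proof.
by move=> /degree_leP mn /degree_leP np; apply/degree_leP => i; exact: leq_trans (mn i) (np i).
Qed.

Lemma degree_le0 k (m : degree k) : degree_le 0 m.
Proof. by apply/degree_leP => i; rewrite ffunE. Qed.

Lemma degree_leDr k (m a : degree k) : degree_le m (m + a).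
Proof. by apply/degree_leP => i; rewrite degree_addE leq_addr. Qed.

Lemma degree_le_add2r k (p m n : degree k) :
  degree_le m n -> degree_le (m + p) (n + p).
Proof.
by move=> /degree_leP mn; apply/degree_leP => i; rewrite !degree_addE leq_add2r.
Qed.

Lemma degree_subKC k (m n : degree k) :
  degree_le m n -> m + degree_sub n m = n.
Proof. by move=> /degree_leP mn; apply/ffunP => i; rewrite degree_addE ffunE subnKC. Qed.

Lemma degree_addKl k (m n : degree k) : degree_sub (m + n) m = n.
Proof. by apply/ffunP => i; rewrite ffunE degree_addE addKn. Qed.

Lemma degree_addI k (m n p : degree k) : m + n = m + p -> n = p.
Proof. by move=> /(congr1 (fun u => degree_sub u m)); rewrite !degree_addKl. Qed.

Lemma zdiff_eq k (l m l' m' : degree k) :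
  (zdiff l m = zdiff l' m') <-> (l + m' = l' + m).
Proof.
split=> /ffunP E; apply/ffunP => i; move: (E i); rewrite ?degree_addE !ffunE.
  move/eqP; rewrite subr_eq addrAC eq_sym subr_eq -!PoszD => /eqP[] e.
  exact/esym.
move=> e; apply/eqP; rewrite subr_eq addrAC eq_sym subr_eq -!PoszD.
by apply/eqP; congr Posz; exact/esym.
Qed.

Lemma zdiffN k (l m : degree k) : - zdiff l m = zdiff m l.
Proof. by apply/ffunP => i; rewrite !ffunE opprB. Qed.

Lemma zdiffD k (l m l' m' : degree k) :
  zdiff l m + zdiff l' m' = zdiff (l + l') (m + m').
Proof. by apply/ffunP => i; rewrite !(degree_addE, ffunE) !PoszD opprD addrACA. Qed.

(* [cmp] is the juxtaposition [ab], defined when the source of [a] is the range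
   of [b]. *)
Record category := Category {
  obj : Type;
  mor : Type;
  rng : mor -> obj;
  src : mor -> obj;
  idm : obj -> mor;
  cmp : forall a b : mor, src a = rng b -> mor;
  rng_idm : forall v, rng (idm v) = v;
  src_idm : forall v, src (idm v) = v;
  rng_cmp : forall a b (e : src a = rng b), rng (cmp e) = rng a;
  src_cmp : forall a b (e : src a = rng b), src (cmp e) = src b;
  cmp_idml : forall a (e : src (idm (rng a)) = rng a), cmp e = a;
  cmp_idmr : forall a (e : src a = rng (idm (src a))), cmp e = a;
  cmpA : forall a b c (ab : src a = rng b) (bc : src b = rng c)
    (ab_c : src (cmp ab) = rng c) (a_bc : src a = rng (cmp bc)),
    cmp ab_c = cmp a_bc
}.
Arguments idm {_} _.

(* Countability is not part of the structure: the skew product by an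
   uncountable group has to be an instance of it. *)
Record kgraph (k : nat) := KGraph {
  kcat :> category;
  deg : mor kcat -> degree k;
  deg_idm : forall v, deg (idm v) = 0;
  deg_cmp : forall (a b : mor kcat) (e : src a = rng b),
    deg (cmp e) = deg a + deg b;
  factorisation : forall (a : mor kcat) (m n : degree k), deg a = m + n ->
    exists! p : mor kcat * mor kcat,
      [/\ exists e : src p.1 = rng p.2, a = cmp e, deg p.1 = m & deg p.2 = n]
}.

Definition countable_kgraph k (L : kgraph k) : Prop := countable [set: mor L].

(* Lambda^n(v) *)
Definition paths_from k (L : kgraph k) (n : degree k) (v : obj L) :
    set (mor L) :=
  [set a | deg a = n /\ rng a = v].

Definition row_finite_no_sources k (L : kgraph k) : Prop :=
  forall (v : obj L) (n : degree k),
    paths_from n v !=set0 /\ finite_set (paths_from n v).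

Record degree_functor k (K L : kgraph k) := DegreeFunctor {
  fobj : obj K -> obj L;
  fmor : mor K -> mor L;
  rng_fmor : forall a, rng (fmor a) = fobj (rng a);
  src_fmor : forall a, src (fmor a) = fobj (src a);
  fmor_idm : forall v, fmor (idm v) = idm (fobj v);
  fmor_cmp : forall a b (e : src a = rng b) (e' : src (fmor a) = rng (fmor b)),
    fmor (cmp e) = cmp e';
  deg_fmor : forall a, deg (fmor a) = deg a
}.

Section KGraphTheory.
Variables (k : nat) (L : kgraph k).
Implicit Types a b : mor L.

Lemma cmp_congr a b a' b' (e : src a = rng b) (e' : src a' = rng b') :
  a = a' -> b = b' -> cmp e = cmp e'.
Proof.
by move=> ? ?; subst a' b'; rewrite (Prop_irrelevance e e').
Qed.

Lemma factor_inj a b a' b' (e : src a = rng b) (e' : src a' = rng b') :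
  cmp e = cmp e' -> deg a = deg a' -> a = a' /\ b = b'.
Proof.
move=> E da.
have db : deg b = deg b'.
  by apply: (@degree_addI _ (deg a)); rewrite -deg_cmp E deg_cmp da.
have [p [_ U]] := factorisation (deg_cmp e).
have p1 : p = (a, b) by apply: U; split=> //; exists e.
have p2 : p = (a', b') by apply: U; split=> //; exists e'.
by move: p1; rewrite p2 => -[-> ->].
Qed.

End KGraphTheory.

Section Omega.
Variable k : nat.

Definition omega_mor := {p : degree k * degree k | degree_le p.1 p.2}.

Definition omega (m n : degree k) (mn : degree_le m n) : omega_mor :=
  exist (fun p : degree k * degree k => degree_le p.1 p.2) (m, n) mn.

Let orng (a : omega_mor) : degree k := (sval a).1.
Let osrc (a : omega_mor) : degree k := (sval a).2.

Fact omega_cmp_subproof (a b : omega_mor) : osrc a = orng b ->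
  degree_le (orng a) (osrc b).
Proof.
move=> e; apply: (@degree_le_trans _ (osrc a)); first exact: svalP a.
by rewrite e; exact: svalP b.
Qed.

Definition omega_cat : category.
Proof.
refine (@Category (degree k) omega_mor orng osrc
  (fun m => omega (degree_le_refl m))
  (fun a b e => omega (omega_cmp_subproof e)) _ _ _ _ _ _ _) => //.
- by move=> a e; apply: val_inj; case: a e => -[].
- by move=> a e; apply: val_inj; case: a e => -[].
- by move=> a b c ab bc ab_c a_bc; apply: val_inj.
Defined.

Definition Omega : kgraph k.
Proof.
refine (@KGraph k omega_cat (fun a : omega_mor => degree_sub (osrc a) (orng a)) _ _ _).
- by move=> v; apply/ffunP => i; rewrite !ffunE subnn.
- move=> [[a a'] /= ha] [[b b'] /= hb] e.
  have /= eab : a' = b by []. 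
  have /degree_leP ha' := ha; have /degree_leP hb' := hb; rewrite /orng /osrc /=.
  apply/ffunP => i; rewrite degree_addE !ffunE; move: (ha' i) (hb' i); rewrite eab.
  by move=> h1 h2; rewrite addnC addnBA // subnK.
- move=> [[a b] /= ab] m n; rewrite /orng /osrc /= => E.
  have eb : b = a + m + n by rewrite -addrA -E degree_subKC.
  subst b.
  exists (omega (degree_leDr a m), omega (degree_leDr (a + m) n)); split => /=.
    split; rewrite /orng /osrc /= ?degree_addKl //.
    by unshelve eexists => //; apply: val_inj.
  move=> [[[p p'] /= pp'] [[q q'] /= qq']]; rewrite /orng /osrc /=.
  move=> [[e /(congr1 sval) /= [? ?]] Em En].
  have /= epq : p' = q by []; subst p q q'.
  have ep : p' = a + m by rewrite -Em degree_subKC.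
  by subst p'; congr (_, _); apply: val_inj.
Defined.

End Omega.

Notation infinite_path L := (degree_functor (Omega _) L).

Section Paths.
Variables (k : nat) (L : kgraph k).
Implicit Types x y : infinite_path L.

(* x(0,n) *)
Definition seg x (n : degree k) : mor L :=
  fmor x (omega (degree_le0 n)).

Definition omega_shift (p : degree k) (a : omega_mor k) : omega_mor k :=
  omega (degree_le_add2r p (svalP a)).

Definition shift (p : degree k) x : infinite_path L.
Proof.
refine (@DegreeFunctor k (Omega k) L
  (fun m : degree k => fobj x (m + p)) (fun a => fmor x (omega_shift p a))
  _ _ _ _ _).
- by move=> a; rewrite rng_fmor.
- by move=> a; rewrite src_fmor.
- move=> v; rewrite -fmor_idm; congr fmor; exact: val_inj.
- move=> a b e e'.
  have es : @src (Omega k) (omega_shift p a) = @rng (Omega k) (omega_shift p b).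
    by have /= := congr1 (fun u : degree k => u + p) e.
  rewrite -(fmor_cmp es); congr fmor; exact: val_inj.
- move=> a; rewrite deg_fmor /=; apply/ffunP => i.
  by rewrite !ffunE subnDr.
Defined.

(* [y] is the infinite path [a z]; by [concat_uniq] there is at most one. *)
Definition is_concat (a : mor L) (z y : infinite_path L) : Prop :=
  [/\ fobj z (0 : degree k) = src a, shift (deg a) y = z & seg y (deg a) = a].

Lemma infinite_path_ext x y : (forall a, fmor x a = fmor y a) -> x = y.
Proof.
case: x y => [xo xm x1 x2 x3 x4 x5] [yo ym y1 y2 y3 y4 y5] /= E.
have Em : xm = ym by apply/funext.
subst ym.
have Eo : xo = yo.
  apply/funext => v; have := x1 (idm v); rewrite y1.
  by rewrite rng_idm => ->.
subst yo.
by congr DegreeFunctor; exact: Prop_irrelevance.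
Qed.

Lemma deg_seg x n : deg (seg x n) = n.
Proof. by rewrite deg_fmor /=; apply/ffunP => i; rewrite !ffunE subn0. Qed.

Lemma rng_seg x n : rng (seg x n) = fobj x (0 : degree k).
Proof. by rewrite rng_fmor. Qed.

Lemma src_seg x n : src (seg x n) = fobj (shift n x) (0 : degree k).
Proof. by rewrite src_fmor /= add0r. Qed.

Lemma shiftD l m x : shift (l + m) x = shift m (shift l x).
Proof.
apply: infinite_path_ext => a /=; congr fmor; apply: val_inj => /=.
by rewrite [l + m]addrC !addrA.
Qed.

Lemma src_seg_rng x l a : src (seg x l) = rng (seg (shift l x) a).
Proof. by rewrite src_seg rng_seg. Qed.

Lemma segD x l a : seg x (l + a) = cmp (src_seg_rng x l a).
Proof.
have e : @src (Omega k) (omega (degree_le0 l))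
    = @rng (Omega k) (omega_shift l (omega (degree_le0 a))).
  by rewrite /= /omega_shift /= add0r.
rewrite -(fmor_cmp e); congr fmor; apply: val_inj => /=.
by rewrite addrC.
Qed.

Lemma seg_inj x y l a : seg x (l + a) = seg y (l + a) ->
  seg x l = seg y l /\ seg (shift l x) a = seg (shift l y) a.
Proof.
rewrite !segD => E.
by have := factor_inj E; rewrite !deg_seg; apply.
Qed.

Lemma fmor_seg x m n (mn : degree_le m n) :
  fmor x (omega mn) = seg (shift m x) (degree_sub n m).
Proof.
congr fmor; apply: val_inj => /=.
by rewrite add0r addrC degree_subKC.
Qed.

Lemma concat_uniq x y l :
  seg x l = seg y l -> shift l x = shift l y -> x = y.
Proof.
move=> Es Eh.
have Eseg n : seg x n = seg y n.
  have : seg x (l + n) = seg y (l + n).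
    by rewrite !segD; apply: cmp_congr => //; rewrite Eh.
  by rewrite addrC => /seg_inj [].
apply: infinite_path_ext => -[[m n] mn].
rewrite -[exist _ _ _]/(omega mn) !fmor_seg.
have := Eseg (m + degree_sub n m).
by move=> /seg_inj [].
Qed.

End Paths.

(* A groupoid presented by its arrows, composable pairs, partial product and
   inverse; units are the arrows of the form [a a^-1]. *)
Record groupoid := Groupoid {
  arrow : topologicalType;
  composable : arrow -> arrow -> Prop;
  gmul : forall a b : arrow, composable a b -> arrow;
  ginv : arrow -> arrow;
  ginvK : involutive ginv;
  composable_mull : forall a b c (ab : composable a b), composable b c ->
    composable (gmul ab) c;
  composable_mulr : forall a b c (bc : composable b c), composable a b ->
    composable a (gmul bc);
  gmulA : forall a b c (ab : composable a b) (bc : composable b c)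
    (ab_c : composable (gmul ab) c) (a_bc : composable a (gmul bc)),
    gmul ab_c = gmul a_bc;
  composable_Vg : forall a, composable (ginv a) a;
  composable_gV : forall a, composable a (ginv a);
  gmulKV : forall a b (ab : composable a b)
    (e : composable (ginv a) (gmul ab)), gmul e = b;
  gmulVK : forall a b (ab : composable a b)
    (e : composable (gmul ab) (ginv b)), gmul e = a;
  ginv_continuous : continuous ginv;
  (* continuity for the topology on composable pairs induced from the product *)
  gmul_continuous : forall a b (ab : composable a b) (A : set arrow),
    nbhs (gmul ab) A -> exists U V, [/\ nbhs a U, nbhs b V &
      forall a' b' (ab' : composable a' b'), U a' -> V b' -> A (gmul ab')]
}.

Definition groupoid_isomorphic (H K : groupoid) : Prop :=
  exists (f : arrow H -> arrow K) (g : arrow K -> arrow H),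
    [/\ cancel f g, cancel g f, continuous f, continuous g &
      forall a b, (composable a b <-> composable (f a) (f b)) /\
        forall (ab : composable a b) (fab : composable (f a) (f b)),
          f (gmul ab) = gmul fab].

Record cocycle (H : groupoid) (G : groupType) := Cocycle {
  cocycle_fun :> arrow H -> G;
  cocycleM : forall a b (ab : composable a b),
    cocycle_fun (gmul ab) = (cocycle_fun a * cocycle_fun b)%g;
  cocycle_continuous :
    continuous (cocycle_fun : arrow H -> discrete_topology G)
}.

(* The triple (x, n, y), with range x = [ptgt] and source y = [psrc]. *)
Record path_arrow k (L : kgraph k) := PathArrow {
  ptgt : infinite_path L;
  plag : zdegree k;
  psrc : infinite_path L;
  path_arrowP : exists l m : degree k,
    shift l ptgt = shift m psrc /\ plag = zdiff l m
}.

HB.instance Definition _ k (L : kgraph k) := gen_eqMixin (path_arrow L).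
HB.instance Definition _ k (L : kgraph k) := gen_choiceMixin (path_arrow L).

Section PathGroupoid.
Variables (k : nat) (L : kgraph k).
Implicit Types g h : path_arrow L.

(* Z(a,b) *)
Definition cylinder (a b : mor L) : set (path_arrow L) :=
  [set g | exists z : infinite_path L,
    [/\ is_concat a z (ptgt g), plag g = zdiff (deg a) (deg b)
      & is_concat b z (psrc g)]].

Definition cylinders : set (set (path_arrow L)) :=
  [set A | exists a b : mor L, src a = src b /\ A = cylinder a b].

Lemma path_arrow_ext g h :
  ptgt g = ptgt h -> plag g = plag h -> psrc g = psrc h -> g = h.
Proof.
case: g h => [x n y p] [x' n' y' p'] /= ? ? ?; subst x' n' y'.
by congr PathArrow; exact: Prop_irrelevance.
Qed.

Definition repr g (l m : degree k) : Prop :=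
  shift l (ptgt g) = shift m (psrc g) /\ plag g = zdiff l m.

Definition seg_cylinder g (l m : degree k) : set (path_arrow L) :=
  cylinder (seg (ptgt g) l) (seg (psrc g) m).

Lemma seg_cylinderP g l m h : seg_cylinder g l m h <->
  [/\ repr h l m, seg (ptgt h) l = seg (ptgt g) l,
      seg (psrc h) m = seg (psrc g) m
    & src (seg (ptgt g) l) = src (seg (psrc g) m)].
Proof.
rewrite /seg_cylinder /cylinder /is_concat /= !deg_seg; split.
  move=> [z [[z0 z1 z2] z3 [z4 z5 z6]]]; split => //.
    by split => //; rewrite z1.
  by rewrite -z0 -z4.
move=> [[h1 h2] h3 h4 h5]; exists (shift l (ptgt h)); split; first split => //.
- by rewrite -h3 src_seg.
- by [].
- by split => //; rewrite -?h1 // h1 -h4 src_seg.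
Qed.

Lemma seg_cylinder_refl g l m : repr g l m -> seg_cylinder g l m g.
Proof. by move=> gr; apply/seg_cylinderP; split=> //; rewrite !src_seg gr.1. Qed.

Lemma cylinder_seg a b g : cylinder a b g ->
  repr g (deg a) (deg b) /\ cylinder a b = seg_cylinder g (deg a) (deg b).
Proof.
move=> [z [[z0 z1 z2] z3 [z4 z5 z6]]]; split; last by rewrite /seg_cylinder z2 z6.
by split => //; rewrite z1.
Qed.

Lemma reprD g l m a : repr g l m -> repr g (l + a) (m + a).
Proof.
move=> [E n]; split; first by rewrite !shiftD E.
by rewrite n; apply/zdiff_eq; rewrite -[RHS]addrA [a + m]addrC.
Qed.

Lemma seg_cylinderD g l m a : repr g l m ->
  seg_cylinder g (l + a) (m + a) `<=` seg_cylinder g l m.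
Proof.
move=> [E gn] h /seg_cylinderP [[h1 h2] h3 h4 _].
have [s1 s2] := seg_inj h3; have [s3 s4] := seg_inj h4.
apply/seg_cylinderP; split => //; last by rewrite !src_seg E.
split; last first.
  rewrite h2; apply/zdiff_eq.
  by rewrite -addrA [a + m]addrC.
apply: (@concat_uniq _ _ _ _ a); first by rewrite s2 s4 E.
by rewrite -!shiftD.
Qed.

Lemma seg_cylinder_join g l m l' m' : repr g l m -> repr g l' m' ->
  exists p q, [/\ repr g p q, seg_cylinder g p q `<=` seg_cylinder g l m
    & seg_cylinder g p q `<=` seg_cylinder g l' m'].
Proof.
move=> r1 r2; exists (l + l'), (m + l').
have E : m + l' = m' + l.
  have /zdiff_eq e := etrans (esym r1.2) r2.2.
  by rewrite addrC -e addrC.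
split; [exact: reprD|exact: seg_cylinderD|].
by rewrite E addrC; exact: seg_cylinderD.
Qed.

Fact cylinders_cover : \bigcup_(A in cylinders) id A = setT.
Proof.
rewrite -subTset => g _; have [l [m gr]] := path_arrowP g.
exists (seg_cylinder g l m); last exact: seg_cylinder_refl.
exists (seg (ptgt g) l), (seg (psrc g) m); split => //.
by rewrite !src_seg gr.1.
Qed.

Lemma cylinders_seg g l m : repr g l m -> cylinders (seg_cylinder g l m).
Proof.
move=> gr; exists (seg (ptgt g) l), (seg (psrc g) m); split => //.
by rewrite !src_seg gr.1.
Qed.

Fact cylinders_join (A B : set (path_arrow L)) g :
  cylinders A -> cylinders B -> id A g -> id B g ->
  exists C, [/\ cylinders C, id C g & id C `<=` id A `&` id B].
Proof.
move=> [a [b [_ ->]]] [a' [b' [_ ->]]] /cylinder_seg [r1 ->] /cylinder_seg [r2 ->].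
have [p [q [r s1 s2]]] := seg_cylinder_join r1 r2.
exists (seg_cylinder g p q); split.
- exact: cylinders_seg.
- exact: seg_cylinder_refl.
- by move=> h hh; split; [exact: s1|exact: s2].
Qed.

End PathGroupoid.

HB.instance Definition _ k (L : kgraph k) :=
  isBaseTopological.Build (path_arrow L) (@cylinders_cover k L)
    (@cylinders_join k L).

Section PathGroupoidStructure.
Variables (k : nat) (L : kgraph k).
Implicit Types g h : path_arrow L.

Lemma open_cylinders (A : set (path_arrow L)) : cylinders A -> open A.
Proof.
move=> cA; exists [set A]; first by move=> _ ->.
by rewrite bigcup_set1.
Qed.

Lemma nbhs_path_arrow g (A : set (path_arrow L)) : nbhs g A <->
  exists l m, repr g l m /\ seg_cylinder g l m `<=` A.
Proof.
split.
  rewrite nbhsE => -[B [[D DC <-] [C DcC Cg]] BA].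
  have [a [b [_ CE]]] := DC _ DcC.
  move: (Cg); rewrite /= CE => /cylinder_seg [r E]; exists (deg a), (deg b).
  by split => // h; rewrite -E -CE => Ch; apply: BA; exists C.
move=> [l [m [r sA]]]; apply: filterS sA _; apply: open_nbhs_nbhs; split.
  exact/open_cylinders/cylinders_seg.
exact: seg_cylinder_refl.
Qed.

Fact path_mul_subproof g h : psrc g = ptgt h ->
  exists l m : degree k,
    shift l (ptgt g) = shift m (psrc h) /\ plag g + plag h = zdiff l m.
Proof.
have [p [q [E1 n1]]] := path_arrowP g; have [a [b [E2 n2]]] := path_arrowP h.
move=> E; exists (p + a), (b + q); split; last by rewrite n1 n2 zdiffD [b + q]addrC.
by rewrite shiftD E1 E -shiftD [q + a]addrC (shiftD a) E2 -shiftD.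
Qed.

Definition path_mul g h (gh : psrc g = ptgt h) : path_arrow L :=
  PathArrow (path_mul_subproof gh).

Fact path_inv_subproof g :
  exists l m : degree k,
    shift l (psrc g) = shift m (ptgt g) /\ - plag g = zdiff l m.
Proof.
have [p [q [E n]]] := path_arrowP g.
by exists q, p; rewrite n zdiffN.
Qed.

Definition path_inv g : path_arrow L := PathArrow (path_inv_subproof g).

Lemma path_inv_continuous : continuous path_inv.
Proof.
move=> g A /nbhs_path_arrow [l [m [[E n] sA]]].
apply/nbhs_path_arrow; exists m, l.
have r : repr g m l by split=> //; rewrite -[plag g]opprK [- plag g]n zdiffN.
split => // h /seg_cylinderP [[h1 h2] h3 h4 h5]; apply: sA.
apply/seg_cylinderP; split => //.
by split => //=; rewrite h2 zdiffN.
Qed.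

Lemma path_mul_continuous g h (gh : psrc g = ptgt h) (A : set (path_arrow L)) :
  nbhs (path_mul gh) A -> exists U V, [/\ nbhs g U, nbhs h V &
    forall g' h' (gh' : psrc g' = ptgt h'), U g' -> V h' -> A (path_mul gh')].
Proof.
move=> /nbhs_path_arrow [l [m [r sA]]].
have [p [q r1]] := path_arrowP g; have [a [b r2]] := path_arrowP h.
have E : (p + a) + m = l + (q + b).
  by apply/zdiff_eq; rewrite -zdiffD -r1.2 -r2.2 -r.2.
have r1' : repr g (l + (p + a)) (q + (l + a)).
  by have := reprD (l + a) r1; rewrite addrCA.
have Eb : b + (l + q) = m + (p + a).
  by rewrite [RHS]addrC E addrCA [b + q]addrC.
have r2' : repr h (q + (l + a)) (m + (p + a)).
  have Ea : a + (l + q) = q + (l + a) by rewrite addrCA [a + q]addrC addrCA.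
  by have := reprD (l + q) r2; rewrite Eb Ea.
exists (seg_cylinder g (l + (p + a)) (q + (l + a))).
exists (seg_cylinder h (q + (l + a)) (m + (p + a))); split.
- by apply/nbhs_path_arrow; exists (l + (p + a)), (q + (l + a)); split.
- by apply/nbhs_path_arrow; exists (q + (l + a)), (m + (p + a)); split.
move=> g' h' gh' /seg_cylinderP [[g1 g2] g3 g4 g5].
move=> /seg_cylinderP [[h1 h2] h3 h4 h5].
apply/sA/(seg_cylinderD (a := p + a) r).
apply/seg_cylinderP; split => //=.
  split => /=; first by rewrite g1 gh' h1.
  rewrite g2 h2 zdiffD; apply/zdiff_eq.
  exact/esym/addrA.
by rewrite g5 gh h5.
Qed.

Definition path_groupoid : groupoid.
Proof.
refine (@Groupoid (path_arrow L) (fun g h => psrc g = ptgt h) path_mul path_inv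
  _ _ _ _ _ _ _ _ path_inv_continuous path_mul_continuous) => //.
- by move=> g; apply: path_arrow_ext => //=; rewrite opprK.
- by move=> a b c ab bc ? ?; apply: path_arrow_ext => //=; rewrite addrA.
- by move=> a b ab e; apply: path_arrow_ext => //=; rewrite addKr.
- by move=> a b ab e; apply: path_arrow_ext => //=; rewrite addrK.
Defined.

End PathGroupoidStructure.

Record group_functor (C : category) (G : groupType) := GroupFunctor {
  gfun :> mor C -> G;
  gfunM : forall a b (e : src a = rng b), gfun (cmp e) = (gfun a * gfun b)%g;
  gfun1 : forall v, gfun (idm v) = 1%g
}.

Section SkewGraph.
Variables (k : nat) (G : groupType) (L : kgraph k) (c : group_functor L G).

Let sobj := (G * obj L)%type.
Let smor := (G * mor L)%type.
Let srng (a : smor) : sobj := (a.1, rng a.2).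
Let ssrc (a : smor) : sobj := ((a.1 * c a.2)%g, src a.2).

Definition skew_cat : category.
Proof.
refine (@Category sobj smor srng ssrc (fun v => (v.1, idm v.2))
  (fun a b e => (a.1, cmp (congr1 snd e))) _ _ _ _ _ _ _).
- by move=> [g v]; rewrite /srng /= rng_idm.
- by move=> [g v]; rewrite /ssrc /= src_idm gfun1 mulg1.
- by move=> a b e; rewrite /srng /= rng_cmp.
- move=> a b e; rewrite /ssrc /= src_cmp gfunM mulgA.
  by congr (_, _); have /= := congr1 fst e; rewrite /= => ->.
- by move=> [g a] e /=; rewrite cmp_idml.
- by move=> [g a] e /=; rewrite cmp_idmr.
- by move=> a b d ab bd ? ? /=; congr (_, _); exact: cmpA.
Defined.

Definition skew_graph : kgraph k.
Proof.
refine (@KGraph k skew_cat (fun a : smor => deg a.2) _ _ _).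
- by move=> v; rewrite deg_idm.
- by move=> a b e; rewrite deg_cmp.
- move=> [g a] m n /= E; have [[u v] [[/= [e ae] du dv] U]] := factorisation E.
  exists ((g, u), ((g * c u)%g, v)); split => /=.
    split => //.
    have e' : ssrc (g, u) = srng ((g * c u)%g, v) by rewrite /ssrc /srng /= e.
    by exists e'; rewrite ae; congr (_, _); exact: cmp_congr.
  move=> [[g1 u1] [g2 v1]] /= [[e1 [gg ae1]] du1 dv1].
  have /= h1 : (g1 * c u1)%g = g2 := congr1 fst e1.
  have [eu ev] : (u, v) = (u1, v1).
    by apply: U; split=> //; exists (congr1 snd e1).
  by rewrite -h1 gg eu ev.
Defined.

End SkewGraph.

Section SkewGroupoid.
Variables (H : groupoid) (G : groupType) (c : cocycle H G).

Definition skew_arrow : topologicalType :=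
  (arrow H * discrete_topology G)%type.

Definition skew_composable (a b : skew_arrow) : Prop :=
  composable a.1 b.1 /\ b.2 = (a.2 * c a.1)%g :> G.

Definition skew_mul (a b : skew_arrow) (ab : skew_composable a b) : skew_arrow :=
  (gmul (proj1 ab), a.2).

Definition skew_inv (a : skew_arrow) : skew_arrow :=
  (ginv a.1, (a.2 * c a.1)%g).

Lemma skew_inv_continuous : continuous skew_inv.
Proof.
move=> [a g] A [[U V] /= [nU nV] sA].
have cU : nbhs a (c @^-1` [set c a]).
  exact: (cocycle_continuous (discrete_set1 (c a : discrete_topology G))).
have iU := ginv_continuous nU.
exists ((@ginv H @^-1` U) `&` (c @^-1` [set c a]), [set g]) => /=.
  by split; [exact: filterI|exact: discrete_set1].
move=> [b h] /= [[Ub cb] ->]; apply: sA; split => //=.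
by rewrite cb; exact: nbhs_singleton nV.
Qed.

Lemma skew_mul_continuous a b (ab : skew_composable a b) (A : set skew_arrow) :
  nbhs (skew_mul ab) A -> exists U V, [/\ nbhs a U, nbhs b V &
    forall a' b' (ab' : skew_composable a' b'), U a' -> V b' -> A (skew_mul ab')].
Proof.
case: a b ab => [a g] [b h] ab [[U V] /= [nU nV] sA].
have [U1 [U2 [n1 n2 sU]]] := gmul_continuous nU.
exists (U1 `*` [set g : discrete_topology G]), (U2 `*` setT); split.
- by exists (U1, [set g : discrete_topology G]) => //=; split => //; exact: discrete_set1.
- by exists (U2, setT) => //=; split => //; exact: filterT.
move=> [a' g'] [b' h'] ab' [/= U1a gg] [/= U2b _]; apply: sA.
by split; [exact: sU|rewrite /= gg; exact: nbhs_singleton nV].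
Qed.

Lemma cocycleV a : c (ginv a) = (c a)^-1%g.
Proof.
have e := composable_gV a.
have e' : composable (gmul e) (ginv (ginv a)).
  by apply: composable_mull; exact: composable_gV.
have := congr1 c (gmulVK e'); rewrite !cocycleM ginvK => E.
have {}E : (c a * c (ginv a) = 1)%g by apply: (mulIg (c a)); rewrite mul1g.
by apply: (mulgI (c a)); rewrite E mulgV.
Qed.

Definition skew_groupoid : groupoid.
Proof.
refine (@Groupoid skew_arrow skew_composable skew_mul skew_inv
  _ _ _ _ _ _ _ _ skew_inv_continuous skew_mul_continuous).
- by move=> [a g]; rewrite /skew_inv /= ginvK cocycleV mulgK.
- move=> a b d [ab gab] [bd gbd]; split; first exact: composable_mull.
  by rewrite /= cocycleM mulgA -gab.
- move=> a b d [bd gbd] [ab gab]; split; first exact: composable_mulr.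
  by [].
- by move=> a b d ab bd ? ?; congr (_, _); exact: gmulA.
- move=> a; split; first exact: composable_Vg.
  by rewrite /= cocycleV mulgK.
- by move=> a; split; first exact: composable_gV.
- move=> [a g] [b h] ab e; have /= gab := proj2 ab.
  by congr (_, _); [exact: gmulKV|rewrite /= gab].
- move=> [a g] [b h] ab e; congr (_, _); exact: gmulVK.
Defined.

End SkewGroupoid.

Section InducedCocycle.
Variables (k : nat) (G : groupType) (L : kgraph k) (c : group_functor L G).

(* The common value of c(x(0,l)) c(y(0,m))^-1 over all ways of writing the arrow
   as (x, l-m, y); [xget] only returns its default 1 if there is none, see
   [tilde_funE]. *)
Definition tilde_fun (g : path_arrow L) : G :=
  xget 1%g [set u | exists l m : degree k,
    [/\ shift l (ptgt g) = shift m (psrc g), plag g = zdiff l m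
      & u = (c (seg (ptgt g) l) * (c (seg (psrc g) m))^-1)%g]].

Lemma gfun_segD (x y : infinite_path L) l m a : shift l x = shift m y ->
  (c (seg x (l + a)) * (c (seg y (m + a)))^-1 =
   c (seg x l) * (c (seg y m))^-1)%g.
Proof.
by move=> E; rewrite !segD !gfunM E invgM mulgA mulgK.
Qed.

Lemma tilde_funE (g : path_arrow L) (l m : degree k) :
  shift l (ptgt g) = shift m (psrc g) -> plag g = zdiff l m ->
  tilde_fun g = (c (seg (ptgt g) l) * (c (seg (psrc g) m))^-1)%g.
Proof.
move=> E n; apply: xget_unique; first by exists l, m.
move=> u [l' [m' [E' n' ->]]].
have /zdiff_eq e := etrans (esym n) n'.
by rewrite -(gfun_segD l' E) -(gfun_segD l E') [m + l']addrC -e [l' + l]addrC [l + m']addrC.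
Qed.

Lemma tilde_fun_continuous :
  continuous (tilde_fun : path_arrow L -> discrete_topology G).
Proof.
move=> g A nA; apply/nbhs_path_arrow.
have [l [m [E n]]] := path_arrowP g; exists l, m; split => // h.
move=> /seg_cylinderP [[h1 h2] h3 h4 _] /=.
suff -> : tilde_fun h = tilde_fun g by exact: nbhs_singleton nA.
by rewrite (tilde_funE h1 h2) h3 h4 -(tilde_funE E n).
Qed.

Definition tilde : cocycle (path_groupoid L) G.
Proof.
refine (@Cocycle (path_groupoid L) G tilde_fun _ tilde_fun_continuous).
move=> g h gh.
have [p [q [E1 n1]]] := path_arrowP g; have [a [b [E2 n2]]] := path_arrowP h.
have E1' : shift (p + a) (ptgt g) = shift (q + a) (psrc g).
  by rewrite !shiftD E1.
have E2' : shift (q + a) (ptgt h) = shift (b + q) (psrc h).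
  by rewrite [q + a]addrC !shiftD E2.
have n1' : plag g = zdiff (p + a) (q + a).
  by rewrite n1; apply/zdiff_eq; rewrite -[RHS]addrA [a + q]addrC.
have n2' : plag h = zdiff (q + a) (b + q).
  by rewrite n2; apply/zdiff_eq; rewrite [b + q]addrC addrA [a + q]addrC.
rewrite (tilde_funE E1' n1') (tilde_funE E2' n2').
have E : shift (p + a) (ptgt (path_mul gh)) = shift (b + q) (psrc (path_mul gh)).
  by rewrite /= E1' gh.
rewrite (tilde_funE E) /=; last first.
  by rewrite n1' n2' zdiffD; apply/zdiff_eq; rewrite -addrA.
have -> : psrc g = ptgt h by exact: gh.
by rewrite mulgA mulgVK.
Defined.

End InducedCocycle.

(* Main.v *)
Require Import Defs.
From mathcomp Require Import all_boot all_order all_algebra.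
From mathcomp Require Import all_classical topology.

(** An infinite path of the skew product is an infinite path [x] of [L] together
    with a starting label [g]: its vertex at [n] must be labelled [g c(x(0,n))],
    since every morphism [(h, a)] moves the label from [h] to [h c(a)]. Thus
    [X |-> (base X, proj X)] is a bijection with inverse [lift] ([lift_proj],
    [proj_lift], [base_lift]), and shifting by [n] multiplies the label by
    [c(x(0,n))] on the right ([base_shift], [lift_shift]).

    Consequently, for paths [X], [Y] of the skew product with labels [g], [h] and
    projections [x], [y], the equation between the [l]-shift of [X] and the
    [m]-shift of [Y] amounts to the same equation for [x] and [y] together with
    [g c(x(0,l)) = h c(y(0,m))]. As the cocycle [tilde c] has the value
    [c(x(0,l)) c(y(0,m))^-1] at [(x, l-m, y)], the latter reads
    [h = g (tilde c)(x, l-m, y)], in which [l] and [m] enter only through their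
    difference ([base_psrc]). So an arrow [(X, n, Y)] carries the same
    information as the arrow [(x, n, y)] and the label [g] of its range, and the
    matching of labels required for composition in the skew product groupoid is
    the equality of the labels of the two middle paths. It also follows that
    [(X, n, Y)] and [(x, n, y)] have the same presentations [n = l-m]
    ([repr_skew_to]), and hence that a basic neighbourhood of [(X, n, Y)]
    corresponds to the product of a basic neighbourhood of [(x, n, y)] with the
    singleton of [g] ([seg_cylinder_skew]); this gives continuity both ways. *)

Set Implicit Arguments.
Unset Strict Implicit.
Unset Printing Implicit Defensive.

Import GRing.Theory.
Local Open Scope classical_set_scope.
Local Open Scope ring_scope.

Section SkewPaths.
Variables (k : nat) (G : groupType) (L : kgraph k) (c : group_functor L G).
Implicit Types (x y : infinite_path L) (X Y : infinite_path (skew_graph c)).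

Lemma gfun_seg0 x : c (seg x (0 : degree k)) = 1%g.
Proof.
rewrite -(gfun1 c (fobj x (0 : degree k))) -fmor_idm; congr (c (fmor x _)).
exact: val_inj.
Qed.

(** As [x(0,m) x(m,n) = x(0,n)]; this is what makes the labels of [lift]
    compatible with sources. *)
Lemma gfun_seg_fmor x (a : omega_mor k) :
  (c (seg x (sval a).1) * c (fmor x a) = c (seg x (sval a).2))%g.
Proof.
have e : @src (Omega k) (omega (degree_le0 (sval a).1)) = @rng (Omega k) a.
  by [].
have e' : src (seg x (sval a).1) = rng (fmor x a).
  by rewrite /seg src_fmor rng_fmor e.
rewrite -(gfunM c e') -(fmor_cmp e); congr (c (fmor x _)); exact: val_inj.
Qed.

Definition base X : G := (fobj X (0 : degree k)).1.

Definition proj X : infinite_path L.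
Proof.
refine (@DegreeFunctor k (Omega k) L (fun m => (fobj X m).2)
  (fun a => (fmor X a).2) _ _ _ _ _).
- by move=> a; exact: (congr1 snd (rng_fmor X a)).
- by move=> a; exact: (congr1 snd (src_fmor X a)).
- by move=> v; rewrite fmor_idm.
- move=> a b e e'.
  have E : src (fmor X a) = rng (fmor X b) by rewrite src_fmor rng_fmor e.
  by rewrite (fmor_cmp e E) /=; exact: cmp_congr.
- by move=> a; rewrite -(deg_fmor X).
Defined.

Definition lift (g : G) x : infinite_path (skew_graph c).
Proof.
refine (@DegreeFunctor k (Omega k) (skew_graph c)
  (fun m => ((g * c (seg x m))%g, fobj x m))
  (fun a => ((g * c (seg x (sval a).1))%g, fmor x a)) _ _ _ _ _).
- by move=> a /=; rewrite rng_fmor.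
- by move=> a /=; rewrite src_fmor -mulgA gfun_seg_fmor.
- by move=> v /=; rewrite -fmor_idm.
- move=> a b e e' /=; congr (_, _); exact: fmor_cmp.
- by move=> a; exact: (deg_fmor x a).
Defined.

Lemma proj_lift g x : proj (lift g x) = x.
Proof. exact: infinite_path_ext. Qed.

Lemma base_lift g x : base (lift g x) = g.
Proof. by rewrite /base /= gfun_seg0 mulg1. Qed.

Lemma proj_shift m X : proj (shift m X) = shift m (proj X).
Proof. exact: infinite_path_ext. Qed.

Lemma seg_base_proj X n : seg X n = (base X, seg (proj X) n).
Proof.
by rewrite [LHS]surjective_pairing; congr (_, _); exact: (congr1 fst (rng_seg X n)).
Qed.

Lemma fobj_label X n : (fobj X n).1 = (base X * c (seg (proj X) n))%g.
Proof.
have /= := congr1 fst (src_fmor X (omega (degree_le0 n))).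
rewrite -/(seg X n) => <-.
by have := seg_base_proj X n => /= ->.
Qed.

Lemma base_shift m X : base (shift m X) = (base X * c (seg (proj X) m))%g.
Proof. by rewrite /base /= add0r fobj_label. Qed.

Lemma lift_proj X : lift (base X) (proj X) = X.
Proof.
apply: infinite_path_ext => a /=; rewrite [RHS]surjective_pairing.
congr (_, _); rewrite -fobj_label.
exact/esym/(congr1 fst (rng_fmor X a)).
Qed.

Lemma skew_path_ext X Y : base X = base Y -> proj X = proj Y -> X = Y.
Proof. by move=> eb ep; rewrite -(lift_proj X) -(lift_proj Y) eb ep. Qed.

Lemma lift_shift m g x :
  shift m (lift g x) = lift (g * c (seg x m))%g (shift m x).
Proof.
apply: skew_path_ext; last by rewrite proj_shift !proj_lift.
by rewrite base_shift !base_lift proj_lift.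
Qed.

End SkewPaths.

Section SkewIsomorphism.
Variables (k : nat) (G : groupType) (L : kgraph k) (c : group_functor L G).
Let M := skew_graph c.

Fact proj_arrow_subproof (a : path_arrow M) : exists l m : degree k,
  shift l (proj (ptgt a)) = shift m (proj (psrc a)) /\ plag a = zdiff l m.
Proof.
have [l [m [E n]]] := path_arrowP a.
by exists l, m; rewrite -!proj_shift E.
Qed.

Definition proj_arrow (a : path_arrow M) : path_arrow L :=
  PathArrow (proj_arrow_subproof a).

(** Any presentation [n = l-m] makes the two shifted paths share their starting
    label, which [base_shift] computes from either end; solving for the label of
    the source gives the cocycle. *)
Lemma base_psrc (a : path_arrow M) :
  base (psrc a) = (base (ptgt a) * tilde_fun c (proj_arrow a))%g.
Proof.
have [l [m [E n]]] := path_arrowP a.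
have E' : shift l (proj (ptgt a)) = shift m (proj (psrc a)).
  by rewrite -!proj_shift E.
rewrite (@tilde_funE _ _ _ c (proj_arrow a) l m E' n) /= mulgA.
by rewrite -base_shift E base_shift mulgK.
Qed.

(** From right to left this projects an equation of paths. Conversely, the labels
    of the two shifted paths agree for every presentation of the projected arrow
    because [tilde_fun] can be evaluated at any of them. This is why a basic
    neighbourhood downstairs, taken at an arbitrary [(l, m)], can be lifted at
    the same [(l, m)]. *)
Lemma repr_skew_to (a : path_arrow M) l m :
  Defs.repr (proj_arrow a) l m <-> Defs.repr a l m.
Proof.
split=> [[/= E n]|[E n]]; split=> //=; last by rewrite -!proj_shift E.
apply: skew_path_ext; last by rewrite !proj_shift.
rewrite !base_shift base_psrc (@tilde_funE _ _ _ c (proj_arrow a) l m E n) /=.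
by rewrite mulgA mulgVK.
Qed.

(** An initial segment of a path of the skew product is the projected segment
    with the starting label. Hence a basic neighbourhood of [a] fixes the label
    of the range, and the label of the source is then forced. *)
Lemma seg_cylinder_skew (a b : path_arrow M) l m : Defs.repr a l m ->
  seg_cylinder a l m b <->
  seg_cylinder (proj_arrow a) l m (proj_arrow b) /\ base (ptgt b) = base (ptgt a).
Proof.
move=> ra; split.
  move=> /seg_cylinderP [rb]; rewrite !seg_base_proj.
  move=> /pair_equal_spec [e1 e2] /pair_equal_spec [_ e3] _.
  split => //; apply/seg_cylinderP; split => //; first exact/repr_skew_to.
  by rewrite !src_seg ((repr_skew_to a l m).2 ra).1.
move=> [/seg_cylinderP [/repr_skew_to rb]].
rewrite ![ptgt (proj_arrow _)]/= ![psrc (proj_arrow _)]/= => e1 e2 _ eb.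
apply/seg_cylinderP; split=> //; last by rewrite !src_seg ra.1.
  by rewrite !seg_base_proj e1 eb.
rewrite !seg_base_proj e2; congr (_, _).
(* The labels of the sources agree because both arrows leave the same label
   after their common segments. *)
apply: (mulIg (c (seg (proj (psrc a)) m))).
rewrite -{1}e2 -!base_shift -rb.1 -ra.1 !base_shift.
by rewrite e1 eb.
Qed.

(** The label of the source is the one imposed by [base_psrc]. *)
Fact lift_arrow_subproof (a : path_arrow L) (g : G) : exists l m : degree k,
  shift l (lift c g (ptgt a)) =
    shift m (lift c (g * tilde_fun c a)%g (psrc a)) /\ plag a = zdiff l m.
Proof.
have [l [m [E n]]] := path_arrowP a; exists l, m; split => //.
by rewrite !lift_shift (tilde_funE c E n) E mulgA mulgVK.
Qed.

Definition lift_arrow (a : path_arrow L) (g : G) : path_arrow M :=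
  PathArrow (lift_arrow_subproof a g).

Lemma proj_lift_arrow a g : proj_arrow (lift_arrow a g) = a.
Proof. by apply: path_arrow_ext => //=; rewrite proj_lift. Qed.

Lemma lift_proj_arrow (a : path_arrow M) :
  lift_arrow (proj_arrow a) (base (ptgt a)) = a.
Proof.
by apply: path_arrow_ext => //=; rewrite -?base_psrc lift_proj.
Qed.

Definition skew_to (a : path_arrow M) : skew_arrow (path_groupoid L) G :=
  (proj_arrow a, base (ptgt a)).

Definition skew_from (a : skew_arrow (path_groupoid L) G) : path_arrow M :=
  lift_arrow a.1 a.2.

Lemma skew_toK : cancel skew_to skew_from.
Proof. exact: lift_proj_arrow. Qed.

Lemma skew_fromK : cancel skew_from skew_to.
Proof.
move=> [a g]; rewrite /skew_to /skew_from /=.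
by congr (_, _); [exact: proj_lift_arrow|exact: base_lift].
Qed.

Lemma skew_to_continuous : continuous skew_to.
Proof.
move=> a A [[U V] /= [/nbhs_path_arrow [l [m [r sU]]] nV] sA].
have ra := (repr_skew_to a l m).1 r.
apply/nbhs_path_arrow; exists l, m; split => // b.
move=> /(seg_cylinder_skew _ ra) [ub eb]; apply: sA; split; first exact: sU.
by rewrite /= eb; exact: nbhs_singleton nV.
Qed.

Lemma skew_from_continuous : continuous skew_from.
Proof.
move=> [a g] A /nbhs_path_arrow [l [m [r sA]]].
have ra : Defs.repr a l m.
  by rewrite -(proj_lift_arrow a g); exact/repr_skew_to.
have na : nbhs (a : path_arrow L) (seg_cylinder a l m).
  by apply/nbhs_path_arrow; exists l, m; split.
exists (seg_cylinder a l m, [set g : discrete_topology G]) => /=.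
  by split; [exact: na|exact: discrete_set1].
move=> [b h] /= [ub ->]; apply/sA/(seg_cylinder_skew _ r).
by rewrite !proj_lift_arrow /= !base_lift.
Qed.

(** The condition on labels in the skew product groupoid says, by [base_psrc],
    that the source of [a] and the range of [b] have the same label. *)
Lemma skew_to_composable (a b : path_arrow M) :
  psrc a = ptgt b <-> skew_composable (tilde c) (skew_to a) (skew_to b).
Proof.
split=> [e|[/= ep eb]]; first by split; rewrite /= -?base_psrc e.
by apply: skew_path_ext => //; rewrite base_psrc eb.
Qed.

Lemma skew_path_groupoid_iso :
  groupoid_isomorphic (path_groupoid M) (skew_groupoid (tilde c)).
Proof.
exists skew_to, skew_from; split; [exact: skew_toK|exact: skew_fromK
  |exact: skew_to_continuous|exact: skew_from_continuous|].
move=> a b; split; first exact: skew_to_composable.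
by move=> ab fab; congr (_, _); exact: path_arrow_ext.
Qed.

End SkewIsomorphism.

Theorem theorem5p2 (k : nat) (k_gt0 : (0 < k)%N) (G : groupType)
    (L : kgraph k) (L_countable : countable_kgraph L)
    (L_finite : row_finite_no_sources L) (c : group_functor L G) :
  groupoid_isomorphic (path_groupoid (skew_graph c)) (skew_groupoid (tilde c)).
Proof. exact: skew_path_groupoid_iso. Qed.
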